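(* Let $X$ be a set and $\alpha:X\to UX$ a map. Then $\alpha$ comes from a consequence relation on $X$ (that is, there is a consequence relation $\vdash$ on $X$ with $\alpha(x)=\{A\subseteq X\mid A\vdash x\}$ for all $x\in X$) if and only if $$\eta_X(x)\subseteq\alpha(x)\qquad\text{and}\qquad(\mu_X\cdot U\alpha\cdot\alpha)(x)\subseteq\alpha(x)$$ for all $x\in X$, that is, $\eta_X\le\alpha$ and $\alpha*\alpha\le\alpha$.
   Context: $PX$ denotes the powerset of $X$. A consequence relation $\vdash$ on $X$ is a relation $\vdash$ from $PX$ to $X$ such that for all $A,B\subseteq X$ and $x\in X$: (1) if $x\in A$ then $A\vdash x$; (2) if $A\vdash x$ and $A\subseteq B$ then $B\vdash x$; (3) if $A\vdash y$ for all $y\in B$ and $B\vdash x$, then $A\vdash x$. The up-set functor $U:\mathsf{Set}\to\mathsf{Set}$ sends $X$ to $UX=\{\mathcal{A}\subseteq PX\mid\mathcal{A}\text{ is up-closed}\}$ (up-closed: $A\in\mathcal{A}$ and $A\subseteq B\subseteq X$ imply $B\in\mathcal{A}$) and $f:X\to Y$ to $Uf:UX\to UY$, $Uf(\mathcal{A})=\{B\subseteq Y\mid f^{-1}(B)\in\mathcal{A}\}$. Put $\eta_X:X\to UX$, $\eta_X(x)=\{A\subseteq X\mid x\in A\}$, and $\mu_X:UUX\to UX$, $\mu_X(\mathfrak{A})=\{A\subseteq X\mid A^\#\in\mathfrak{A}\}$, where $A^\#=\{\mathcal{A}\in UX\mid A\in\mathcal{A}\}$. For maps $\rho:Y\to UX$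 and $\sigma:Z\to UY$, $\rho*\sigma:=\mu_X\cdot U\rho\cdot\sigma:Z\to UX$. For $\rho,\rho':Y\to UX$, $\rho\le\rho'$ means $\rho(y)\subseteq\rho'(y)$ for all $y\in Y$. *)

(* Defs.v *)
From mathcomp Require Import all_boot.
From mathcomp Require Import boolp classical_sets.

Set Implicit Arguments.
Unset Strict Implicit.
Unset Printing Implicit Defensive.

Local Open Scope classical_set_scope.

Definition consequence_relation (X : Type) (ent : set X -> X -> Prop) : Prop :=
  [/\ forall (A : set X) (x : X), A x -> ent A x,
      forall (A B : set X) (x : X), ent A x -> A `<=` B -> ent B x
    & forall (A B : set X) (x : X),
        (forall y : X, B y -> ent A y) -> ent B x -> ent A x].

Definition up_closed (X : Type) (F : set (set X)) : Prop :=
  forall A B : set X, F A -> A `<=` B -> F B.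

Record upset (X : Type) : Type := Upset {
  upset_val :> set (set X);
  upset_up_closed : up_closed upset_val }.

Lemma umap_up_closed (X Y : Type) (f : X -> Y) (F : upset X) :
  up_closed [set B : set Y | upset_val F (f @^-1` B)].
Proof.
move=> A B /= FA AB; apply: upset_up_closed FA _ => x; exact: AB.
Qed.

Definition umap (X Y : Type) (f : X -> Y) (F : upset X) : upset Y :=
  Upset (@umap_up_closed X Y f F).

Lemma ueta_up_closed (X : Type) (x : X) : up_closed [set A : set X | A x].
Proof. by move=> A B /= Ax; apply. Qed.

Definition ueta (X : Type) (x : X) : upset X := Upset (@ueta_up_closed X x).

Definition sharp (X : Type) (A : set X) : set (upset X) :=
  [set F : upset X | upset_val F A].

Lemma umu_up_closed (X : Type) (FF : upset (upset X)) :
  up_closed [set A : set X | upset_val FF (sharp A)].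
Proof.
move=> A B /= FFA AB; apply: upset_up_closed FFA _ => F FA.
exact: upset_up_closed FA AB.
Qed.

Definition umu (X : Type) (FF : upset (upset X)) : upset X :=
  Upset (@umu_up_closed X FF).

Definition ustar (X Y Z : Type) (rho : Y -> upset X) (sigma : Z -> upset Y) :
    Z -> upset X :=
  @umu X \o umap rho \o sigma.

Definition ule (X Y : Type) (rho rho' : Y -> upset X) : Prop :=
  forall y : Y, rho y `<=` rho' y.

(* Main.v *)
Require Import Defs.
From mathcomp Require Import all_boot.
From mathcomp Require Import boolp classical_sets.

(** Read [alpha x A] as: [A] entails [x]. Unfolding the monad multiplication,
    [A] belongs to [(alpha * alpha) x] exactly when the deductive closure
    [[set y | alpha y A]] of [A] entails [x]. So [eta <= alpha] is reflexivity
    of entailment, and [alpha * alpha <= alpha] says that what follows from the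
    closure of [A] already follows from [A]. This is the instance of cut in
    which the intermediate set is the whole closure; the general instance
    reduces to it, because an intermediate set all of whose elements follow
    from [A] lies inside the closure and [alpha x] is up-closed. Monotonicity
    of entailment is the up-closure of each [alpha x]. *)

Local Open Scope classical_set_scope.

(** The pointwise form of [alpha * alpha]; it holds by computation since
    [alpha @^-1` sharp A] is the deductive closure of [A]. *)
Lemma ustar_closureE (X : Type) (alpha : X -> upset X) (x : X) (A : set X) :
  upset_val (ustar alpha alpha x) A
  = upset_val (alpha x) [set y | upset_val (alpha y) A].
Proof. by []. Qed.

Lemma consequence_relation_ustar_le (X : Type) (alpha : X -> upset X)
    (ent : set X -> X -> Prop) :
  consequence_relation ent ->
  (forall x, upset_val (alpha x) = [set A | ent A x]) ->
  ule (@ueta X) alpha /\ ule (ustar alpha alpha) alpha.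
Proof.
move=> [ent_refl _ ent_cut] alphaE; split=> x A.
  by rewrite alphaE; exact: ent_refl.
rewrite ustar_closureE alphaE /=; apply: ent_cut => y /=.
by rewrite alphaE.
Qed.

Lemma ustar_le_consequence_relation (X : Type) (alpha : X -> upset X) :
  ule (@ueta X) alpha -> ule (ustar alpha alpha) alpha ->
  consequence_relation (fun A x => upset_val (alpha x) A).
Proof.
move=> eta_le star_le; split.
- by move=> A x Ax; exact: eta_le.
- by move=> A B x; exact: upset_up_closed.
- move=> A B x AB Bx; apply: star_le; rewrite ustar_closureE.
  (* [AB] says that [B] is included in the deductive closure of [A]. *)
  exact: upset_up_closed Bx AB.
Qed.

Theorem corollary11 (X : Type) (alpha : X -> upset X) :
  ((exists ent : set X -> X -> Prop,
      consequence_relation ent /\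
      forall x : X, upset_val (alpha x) = [set A : set X | ent A x])
   <->
   (forall x : X,
      upset_val (ueta x) `<=` upset_val (alpha x) /\
      upset_val ((@umu X \o umap alpha \o alpha) x) `<=` upset_val (alpha x)))
  /\
  ((forall x : X,
      upset_val (ueta x) `<=` upset_val (alpha x) /\
      upset_val ((@umu X \o umap alpha \o alpha) x) `<=` upset_val (alpha x))
   <->
   (ule (@ueta X) alpha /\ ule (ustar alpha alpha) alpha)).
Proof.
have pointwiseE : (forall x : X,
      upset_val (ueta x) `<=` upset_val (alpha x) /\
      upset_val ((@umu X \o umap alpha \o alpha) x) `<=` upset_val (alpha x))
   <-> (ule (@ueta X) alpha /\ ule (ustar alpha alpha) alpha).
  split=> [le_alpha|[eta_le star_le] x]; last by split; [exact: eta_le|exact: star_le].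
  by split=> x; have [] := le_alpha x.
split=> //; split=> [[ent [ent_cr alphaE]]|/pointwiseE[eta_le star_le]].
  by apply/pointwiseE; exact: consequence_relation_ustar_le ent_cr alphaE.
exists (fun A x => upset_val (alpha x) A); split=> //.
exact: ustar_le_consequence_relation.
Qed.
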